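(* Let $\mathcal{T}$ be a triangulated category equipped with a non-degenerate $t$-structure $(\mathcal{T}^{\leq 0},\mathcal{T}^{\geq 0})$. Let $a, N$ be integers with $N>0$. Let $P \to E$ and $F \to F'$ be two morphisms in $\mathcal{T}$. Assume that $P \to E$ is an isomorphism in degrees $\geq a - N$ and $E$ is in $\mathcal{T}^{\geq a}$, and that $F \to F'$ is an isomorphism in degrees $\geq a$ and $F' \in \mathcal{T}^{\geq a - N}$. If $P$ is a retract of $F$, then $E$ is a retract of $F'$.
   Context: For a $t$-structure $(\mathcal{T}^{\leq 0},\mathcal{T}^{\geq 0})$ on $\mathcal{T}$ (cohomological indexing), $\mathcal{T}^{\leq n}=\mathcal{T}^{\leq 0}[-n]$, $\mathcal{T}^{\geq n}=\mathcal{T}^{\geq 0}[-n]$, $\tau_{\leq n},\tau_{\geq n}$ are the truncation functors, and $H^n(E)=\tau_{\leq 0}\tau_{\geq 0}(E[n])$ is the $n$-th cohomology functor to the heart. The $t$-structure is non-degenerate if $\bigcap_{n\geq 0}\mathcal{T}^{\geq n}=0=\bigcap_{n\geq 0}\mathcal{T}^{\leq -n}$. A morphism $f\colon E\to F$ is an isomorphism in degree $n$ if $H^n(f)$ is an isomorphism; it is an isomorphism in degrees $\geq a$ if this holds for all $n\geq a$. *)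

(* Defs.v *)
From mathcomp Require Import all_boot order ssralg ssrnum ssrint.
From mathcomp Require Import boolp.

Set Implicit Arguments.
Unset Strict Implicit.
Unset Printing Implicit Defensive.

Import GRing.Theory.
Local Open Scope ring_scope.

Declare Scope cat_scope.
Delimit Scope cat_scope with cat.
Local Open Scope cat_scope.

Record preadditive := Preadditive {
  obj :> Type;
  hom : obj -> obj -> zmodType;
  idm : forall X, hom X X;
  comp : forall X Y Z, hom Y Z -> hom X Y -> hom X Z;
  comp_idl : forall X Y (f : hom X Y), comp (idm Y) f = f;
  comp_idr : forall X Y (f : hom X Y), comp f (idm X) = f;
  compA : forall X Y Z W (h : hom Z W) (g : hom Y Z) (f : hom X Y),
    comp h (comp g f) = comp (comp h g) f;
  compDl : forall X Y Z (g g' : hom Y Z) (f : hom X Y),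
    comp (g + g') f = comp g f + comp g' f;
  compDr : forall X Y Z (g : hom Y Z) (f f' : hom X Y),
    comp g (f + f') = comp g f + comp g f'
}.
Arguments hom {p} X Y.
Arguments idm {p} X.
Arguments comp {p X Y Z} g f.
Notation "g ∘ f" := (comp g f) (at level 40, left associativity) : cat_scope.

Definition is_iso (C : preadditive) (X Y : C) (f : hom X Y) : Prop :=
  exists g : hom Y X, g ∘ f = idm X /\ f ∘ g = idm Y.

Definition isomorphic (C : preadditive) (X Y : C) : Prop :=
  exists f : hom X Y, is_iso f.

Definition is_retract (C : preadditive) (X Y : C) : Prop :=
  exists (i : hom X Y) (r : hom Y X), r ∘ i = idm X.

Definition is_zero (C : preadditive) (Z : C) : Prop :=
  forall X : C, (forall f : hom Z X, f = 0) /\ (forall f : hom X Z, f = 0).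

Definition is_biproduct (C : preadditive) (X Y B : C) : Prop :=
  exists (i1 : hom X B) (i2 : hom Y B) (p1 : hom B X) (p2 : hom B Y),
    [/\ p1 ∘ i1 = idm X, p2 ∘ i2 = idm Y, p1 ∘ i2 = 0, p2 ∘ i1 = 0
      & i1 ∘ p1 + i2 ∘ p2 = idm B].

Definition is_additive (C : preadditive) : Prop :=
  (exists Z : C, is_zero Z) /\
  (forall X Y : C, exists B : C, is_biproduct X Y B).

Record functor (C D : preadditive) := Functor {
  fobj :> C -> D;
  fmap : forall X Y, hom X Y -> hom (fobj X) (fobj Y);
  fmap_id : forall X, fmap (idm X) = idm (fobj X);
  fmap_comp : forall X Y Z (g : hom Y Z) (f : hom X Y),
    fmap (g ∘ f) = fmap g ∘ fmap f
}.
Arguments fmap {C D} F {X Y} f : rename.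

Definition additive_functor (C D : preadditive) (F : functor C D) : Prop :=
  forall (X Y : C) (f g : hom X Y), fmap F (f + g) = fmap F f + fmap F g.

Definition idF (C : preadditive) : functor C C :=
  @Functor C C id (fun X Y f => f) (fun X => erefl) (fun X Y Z g f => erefl).

Section CompF.
Variables (C D E : preadditive) (G : functor D E) (F : functor C D).
Lemma compF_id X : fmap G (fmap F (idm X)) = idm (G (F X)).
Proof. by rewrite !fmap_id. Qed.
Lemma compF_comp X Y Z (g : hom Y Z) (f : hom X Y) :
  fmap G (fmap F (g ∘ f)) = fmap G (fmap F g) ∘ fmap G (fmap F f).
Proof. by rewrite !fmap_comp. Qed.
Definition compF : functor C E :=
  @Functor C E (fun X => G (F X)) (fun X Y f => fmap G (fmap F f))
    compF_id compF_comp.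
End CompF.

Definition nat_isomorphic (C D : preadditive) (F G : functor C D) : Prop :=
  exists eta : forall X : C, hom (F X) (G X),
    (forall X, is_iso (eta X)) /\
    (forall X Y (f : hom X Y), eta Y ∘ fmap F f = fmap G f ∘ eta X).

(* Verdier's axioms: TR1 is dist_iso, dist_id and dist_cone, TR2 is dist_rot,
   TR3 is dist_fill, TR4 is dist_octa.  The shift X |-> X[1] is an
   auto-equivalence with a chosen quasi-inverse X |-> X[-1]; it is not required
   to be a strict automorphism. *)
Record triangulated := Triangulated {
  tcat :> preadditive;
  tcat_additive : is_additive tcat;
  susp : functor tcat tcat;
  desusp : functor tcat tcat;
  susp_additive : additive_functor susp;
  desuspK : nat_isomorphic (compF susp desusp) (idF tcat);
  suspK : nat_isomorphic (compF desusp susp) (idF tcat);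
  dist : forall X Y Z : tcat, hom X Y -> hom Y Z -> hom Z (susp X) -> Prop;
  dist_iso : forall (X Y Z X' Y' Z' : tcat)
      (f : hom X Y) (g : hom Y Z) (h : hom Z (susp X))
      (f' : hom X' Y') (g' : hom Y' Z') (h' : hom Z' (susp X'))
      (a : hom X X') (b : hom Y Y') (c : hom Z Z'),
    is_iso a -> is_iso b -> is_iso c ->
    b ∘ f = f' ∘ a -> c ∘ g = g' ∘ b -> fmap susp a ∘ h = h' ∘ c ->
    dist f g h -> dist f' g' h';
  dist_id : forall X Z : tcat, is_zero Z ->
    dist (idm X) (0 : hom X Z) (0 : hom Z (susp X));
  dist_cone : forall (X Y : tcat) (f : hom X Y),
    exists (Z : tcat) (g : hom Y Z) (h : hom Z (susp X)), dist f g h;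
  dist_rot : forall (X Y Z : tcat)
      (f : hom X Y) (g : hom Y Z) (h : hom Z (susp X)),
    dist f g h <-> dist g h (- fmap susp f);
  dist_fill : forall (X Y Z X' Y' Z' : tcat)
      (f : hom X Y) (g : hom Y Z) (h : hom Z (susp X))
      (f' : hom X' Y') (g' : hom Y' Z') (h' : hom Z' (susp X'))
      (a : hom X X') (b : hom Y Y'),
    dist f g h -> dist f' g' h' -> b ∘ f = f' ∘ a ->
    exists c : hom Z Z', c ∘ g = g' ∘ b /\ fmap susp a ∘ h = h' ∘ c;
  dist_octa : forall (X Y Z A B C : tcat) (f : hom X Y) (g : hom Y Z)
      (j : hom Y A) (k : hom A (susp X))
      (l : hom Z B) (m : hom B (susp X))
      (p : hom Z C) (q : hom C (susp Y)),
    dist f j k -> dist (g ∘ f) l m -> dist g p q ->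
    exists (u : hom A B) (v : hom B C),
      [/\ dist u v (fmap susp j ∘ q),
          u ∘ j = l ∘ g, m ∘ u = k, v ∘ l = p & q ∘ v = fmap susp f ∘ m]
}.
Arguments susp {t}.
Arguments desusp {t}.
Arguments dist {t X Y Z} f g h.

(* X |-> X[n] *)
Definition shift (T : triangulated) (n : int) : functor T T :=
  match n with
  | Posz k => iter k (compF susp) (idF T)
  | Negz k => iter k.+1 (compF desusp) (idF T)
  end.

(* P[n] for a full subcategory given by the predicate P on objects *)
Definition shift_sub (T : triangulated) (P : T -> Prop) (n : int) (X : T) : Prop :=
  exists Y : T, P Y /\ isomorphic X (shift T n Y).

Record trunc_triangle (T : triangulated) (le0 ge1 : T -> Prop) (X : T) :=
  TruncTriangle {
    tt_le : T;
    tt_ge : T;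
    tt_i : hom tt_le X;
    tt_p : hom X tt_ge;
    tt_d : hom tt_ge (susp tt_le);
    tt_le0 : le0 tt_le;
    tt_ge1 : ge1 tt_ge;
    tt_dist : dist tt_i tt_p tt_d
  }.

(* The axioms of Beilinson-Bernstein-Deligne; both halves are strictly full
   subcategories, given by predicates closed under isomorphism. *)
Record t_structure (T : triangulated) := TStructure {
  tle0 : T -> Prop;
  tge0 : T -> Prop;
  tle0_iso : forall X Y : T, isomorphic X Y -> tle0 X -> tle0 Y;
  tge0_iso : forall X Y : T, isomorphic X Y -> tge0 X -> tge0 Y;
  t_hom0 : forall X Y : T, tle0 X -> shift_sub tge0 (-1) Y ->
    forall f : hom X Y, f = 0;
  tle0_sub : forall X : T, tle0 X -> shift_sub tle0 (-1) X;
  tge0_sub : forall X : T, shift_sub tge0 (-1) X -> tge0 X;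
  t_trunc : forall X : T,
    inhabited (trunc_triangle tle0 (shift_sub tge0 (-1)) X)
}.

Definition tle (T : triangulated) (t : t_structure T) (n : int) : T -> Prop :=
  shift_sub (tle0 t) (- n).
Definition tge (T : triangulated) (t : t_structure T) (n : int) : T -> Prop :=
  shift_sub (tge0 t) (- n).

Definition t_nondegenerate (T : triangulated) (t : t_structure T) : Prop :=
  (forall X : T, (forall n : nat, tge t n%:Z X) <-> is_zero X) /\
  (forall X : T, (forall n : nat, tle t (- n%:Z) X) <-> is_zero X).

Section Preadditive.
Variable C : preadditive.
Lemma comp0l (X Y Z : C) (f : hom X Y) : (0 : hom Y Z) ∘ f = 0.
Proof. by apply: (addrI (0 ∘ f)); rewrite -compDl !addr0. Qed.
Lemma comp0r (X Y Z : C) (g : hom Y Z) : g ∘ (0 : hom X Y) = 0.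
Proof. by apply: (addrI (g ∘ 0)); rewrite -compDr !addr0. Qed.
Lemma compNl (X Y Z : C) (g : hom Y Z) (f : hom X Y) : (- g) ∘ f = - (g ∘ f).
Proof. by apply: (addrI (g ∘ f)); rewrite -compDl !subrr comp0l. Qed.
Lemma compNr (X Y Z : C) (g : hom Y Z) (f : hom X Y) : g ∘ (- f) = - (g ∘ f).
Proof. by apply: (addrI (g ∘ f)); rewrite -compDr !subrr comp0r. Qed.
Lemma iso_epi (X Y Z : C) (e : hom X Y) (f g : hom Y Z) :
  is_iso e -> f ∘ e = g ∘ e -> f = g.
Proof.
by move=> [e' [_ ee']] fg; rewrite -[f]comp_idr -[g]comp_idr -ee' !compA fg.
Qed.
Lemma iso_mono (X Y Z : C) (e : hom Y Z) (f g : hom X Y) :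
  is_iso e -> e ∘ f = e ∘ g -> f = g.
Proof.
by move=> [e' [e'e _]] fg; rewrite -[f]comp_idl -[g]comp_idl -e'e -!compA fg.
Qed.
Lemma nat_id_faithful (F : functor C C) : nat_isomorphic F (idF C) ->
  forall (X Y : C) (f g : hom X Y), fmap F f = fmap F g -> f = g.
Proof.
move=> [eta [eta_iso nat]] X Y f g fg; apply: (iso_epi (eta_iso X)).
by have := nat _ _ f; have := nat _ _ g; rewrite fg /= => -> ->.
Qed.
End Preadditive.

Section Triangles.
Variable T : triangulated.

Lemma susp_faithful (X Y : T) (f g : hom X Y) :
  fmap susp f = fmap susp g -> f = g.
Proof. by move=> fg; apply: (nat_id_faithful (suspK T)); rewrite /= fg. Qed.

Lemma desusp_faithful (X Y : T) (f g : hom X Y) :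
  fmap desusp f = fmap desusp g -> f = g.
Proof. by move=> fg; apply: (nat_id_faithful (desuspK T)); rewrite /= fg. Qed.

Lemma susp_full (X Y : T) (g : hom (susp X) (susp Y)) :
  exists f, fmap susp f = g.
Proof.
have [eta [eta_iso nat]] := suspK T.
have [e [eK Ke]] := eta_iso X.
exists (eta Y ∘ fmap desusp g ∘ e); apply: desusp_faithful.
apply: (iso_mono (eta_iso Y)).
by rewrite (nat _ _ (eta Y ∘ fmap desusp g ∘ e)) /= -!compA eK comp_idr.
Qed.

Lemma susp0 (X Y : T) : fmap susp (0 : hom X Y) = 0.
Proof.
by apply: (addrI (fmap susp (0 : hom X Y))); rewrite -susp_additive !addr0.
Qed.

Lemma dist_lift (X Y Z W : T) (f : hom X Y) (g : hom Y Z) (h : hom Z (susp X))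
    (u : hom W Y) :
  dist f g h -> g ∘ u = 0 -> exists v : hom W X, f ∘ v = u.
Proof.
move=> /dist_rot D gu; have [[O O0] _] := tcat_additive T.
have /dist_rot DW := dist_id W O0.
have [|c [_]] := dist_fill (a := u) (b := (0 : hom O Z)) DW D.
  by rewrite gu comp0l.
have [v <-] := susp_full c.
rewrite fmap_id compNl compNr comp_idr -fmap_comp => /oppr_inj/susp_faithful ->.
by exists v.
Qed.

Lemma dist_extend (X Y Z W : T) (f : hom X Y) (g : hom Y Z) (h : hom Z (susp X))
    (u : hom Y W) :
  dist f g h -> u ∘ f = 0 -> exists v : hom Z W, v ∘ g = u.
Proof.
move=> D uf; have [[O O0] _] := tcat_additive T.
have sO0 : is_zero (susp O).
  have id0 : idm (susp O) = 0.
    by rewrite -fmap_id ((O0 O).1 (idm O)) susp0.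
  move=> X'; split=> k; first by rewrite -[k]comp_idr id0 comp0r.
  by rewrite -[k]comp_idl id0 comp0l.
have DW : dist (0 : hom O W) (idm W) (0 : hom W (susp O)).
  by apply/dist_rot; rewrite susp0 oppr0; apply: dist_id.
have [|v [vg _]] := dist_fill (a := (0 : hom X O)) (b := u) D DW.
  by rewrite uf comp0l.
by exists v; rewrite vg comp_idl.
Qed.

End Triangles.

Section Truncation.
Variables (T : triangulated) (t : t_structure T).

Definition trunc (X : T) : trunc_triangle (tle0 t) (shift_sub (tge0 t) (-1)) X :=
  sval (cid (let: inhabits D := t_trunc t X in ex_intro (fun=> True) D I)).

Lemma tle0_susp (X : T) : tle0 t X -> tle0 t (susp X).
Proof.
move=> /tle0_sub [Y [Y0 [f [g [gf fg]]]]].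
have [eta [eta_iso _]] := desuspK T; have [e [eK Ke]] := eta_iso Y.
apply: (tle0_iso (X := Y)) => //; exists (fmap susp g ∘ e).
exists (eta Y ∘ fmap susp f); split.
  by rewrite compA -[eta Y ∘ _ ∘ _]compA -fmap_comp fg fmap_id comp_idr Ke.
by rewrite compA -[fmap susp g ∘ e ∘ _]compA eK comp_idr -fmap_comp gf fmap_id.
Qed.

Lemma tle0_lift (X W : T) (u : hom W X) : tle0 t W ->
  exists! v : hom W (tt_le (trunc X)), tt_i (trunc X) ∘ v = u.
Proof.
case: (trunc X) => A B i p d A0 B1 D W0 /=.
have [|v iv] := dist_lift (u := u) D; first exact: t_hom0 W0 B1 _.
exists v; split=> // v' iv'; apply/eqP; rewrite -subr_eq0; apply/eqP.
apply: susp_faithful; rewrite susp0.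
have i0 : i ∘ (v - v') = 0 by rewrite compDr compNr iv iv' subrr.
have /dist_rot/dist_rot D' := D.
have [|w <-] := dist_lift (u := fmap susp (v - v')) D'.
  by rewrite compNl -fmap_comp i0 susp0 oppr0.
by rewrite (t_hom0 (tle0_susp W0) B1 w) comp0r.
Qed.

Lemma tge1_extend (X W : T) (u : hom X W) : shift_sub (tge0 t) (-1) W ->
  exists! v : hom (tt_ge (trunc X)) W, v ∘ tt_p (trunc X) = u.
Proof.
case: (trunc X) => A B i p d A0 B1 D W1 /=.
have [|v pv] := dist_extend (u := u) D; first exact: t_hom0 A0 W1 _.
exists v; split=> // v' pv'; apply/eqP; rewrite -subr_eq0; apply/eqP.
have p0 : (v - v') ∘ p = 0 by rewrite compDl compNl pv pv' subrr.
have /dist_rot D' := D.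
have [w <-] := dist_extend D' p0.
by rewrite (t_hom0 (tle0_susp A0) W1 w) comp0l.
Qed.

Definition tau_le0_map (X Y : T) (f : hom X Y) :
    hom (tt_le (trunc X)) (tt_le (trunc Y)) :=
  sval (cid (tle0_lift (f ∘ tt_i (trunc X)) (tt_le0 (trunc X)))).

Definition tau_ge1_map (X Y : T) (f : hom X Y) :
    hom (tt_ge (trunc X)) (tt_ge (trunc Y)) :=
  sval (cid (tge1_extend (tt_p (trunc Y) ∘ f) (tt_ge1 (trunc Y)))).

Lemma tau_le0_mapE (X Y : T) (f : hom X Y) :
  tt_i (trunc Y) ∘ tau_le0_map f = f ∘ tt_i (trunc X).
Proof. by rewrite /tau_le0_map; case: cid => v []. Qed.

Lemma tau_ge1_mapE (X Y : T) (f : hom X Y) :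
  tau_ge1_map f ∘ tt_p (trunc X) = tt_p (trunc Y) ∘ f.
Proof. by rewrite /tau_ge1_map; case: cid => v []. Qed.

Lemma tau_le0_map_uniq (X Y : T) (f : hom X Y) v :
  tt_i (trunc Y) ∘ v = f ∘ tt_i (trunc X) -> tau_le0_map f = v.
Proof. by rewrite /tau_le0_map; case: cid => w [_ /= +] => /[apply]. Qed.

Lemma tau_ge1_map_uniq (X Y : T) (f : hom X Y) v :
  v ∘ tt_p (trunc X) = tt_p (trunc Y) ∘ f -> tau_ge1_map f = v.
Proof. by rewrite /tau_ge1_map; case: cid => w [_ /= +] => /[apply]. Qed.

Lemma tau_le0_id X : tau_le0_map (idm X) = idm (tt_le (trunc X)).
Proof. by apply: tau_le0_map_uniq; rewrite comp_idl comp_idr. Qed.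

Lemma tau_le0_comp X Y Z (g : hom Y Z) (f : hom X Y) :
  tau_le0_map (g ∘ f) = tau_le0_map g ∘ tau_le0_map f.
Proof.
by apply: tau_le0_map_uniq; rewrite compA tau_le0_mapE -!compA tau_le0_mapE.
Qed.

Lemma tau_ge1_id X : tau_ge1_map (idm X) = idm (tt_ge (trunc X)).
Proof. by apply: tau_ge1_map_uniq; rewrite comp_idl comp_idr. Qed.

Lemma tau_ge1_comp X Y Z (g : hom Y Z) (f : hom X Y) :
  tau_ge1_map (g ∘ f) = tau_ge1_map g ∘ tau_ge1_map f.
Proof.
by apply: tau_ge1_map_uniq; rewrite -compA tau_ge1_mapE !compA tau_ge1_mapE.
Qed.

Definition tau_le0 : functor T T := Functor tau_le0_id tau_le0_comp.
Definition tau_ge1 : functor T T := Functor tau_ge1_id tau_ge1_comp.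

(* The truncation triangle of a t-structure yields the adjoints tau_le0 and
   tau_ge1 of the inclusions of T^{<=0} and T^{>=1}; the other truncation
   functors are obtained by conjugating them with shifts. *)
Definition tau_le (n : int) : functor T T :=
  compF (shift T (- n)) (compF tau_le0 (shift T n)).
Definition tau_ge (n : int) : functor T T :=
  compF (shift T (1 - n)) (compF tau_ge1 (shift T (n - 1))).

(* H^n, with values in the heart regarded as a full subcategory of T *)
Definition cohomology (n : int) : functor T T :=
  compF (tau_le 0) (compF (tau_ge 0) (shift T n)).

End Truncation.

Definition iso_in_degree (T : triangulated) (t : t_structure T) (E F : T)
    (f : hom E F) (n : int) : Prop :=
  is_iso (fmap (cohomology t n) f).

Definition iso_in_degrees_ge (T : triangulated) (t : t_structure T) (E F : T)
    (f : hom E F) (a : int) : Prop :=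
  forall n : int, a <= n -> iso_in_degree t f n.

(* Main.v *)
Require Import Defs.
From mathcomp Require Import all_boot order ssralg ssrnum ssrint.
From mathcomp Require Import zify.
Local Open Scope ring_scope.

(** Everything rests on [precomp_bij]: if f : X -> Y is an isomorphism in
    degrees >= b, then every morphism from X to an object of T^{>=b} extends
    uniquely along f.  Given a retraction i : P -> F, r : F -> P, apply it
    - to P -> E and the target F', which extends g i to j : E -> F';
    - to F -> F' and the target E, which extends f r to s : F' -> E;
    - to P -> E and the target E, where uniqueness turns
      s j f = s g i = f r i = f into s j = 1.

    To prove [precomp_bij], shift so that b = 1.  Since tau_{>=1} is left
    adjoint to the inclusion of T^{>=1}, it suffices that f1 = tau_{>=1} f is
    an isomorphism.  Long exact cohomology sequences and the abelian structure
    of the heart are avoided by testing f1 on the groups Hom(W, -) with W in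
    T^{<=n}.  For n = 1 bijectivity is the hypothesis on H^1(f), because
    H^1(f) = tau_{<=0} (f1 [1]) and tau_{<=0} is right adjoint to the inclusion
    of T^{<=0}.  The step from n to n + 1 ([tau_ge1_hom_bij]) is the five lemma
    for the truncation triangles
      tau_{<=0} (X1 [1]) -> X1 [1] -> tau_{>=1} (X1 [1]),  X1 = tau_{>=1} X,
    whose third term is tau_{>=1} (X [1]), so that the induction hypothesis
    applies to f[1].  Hence the cone of f1 receives no nonzero map from any
    T^{<=n}; it then lies in every T^{>=n} and vanishes by non-degeneracy. *)

(** * Isomorphisms of objects and of functors *)

Section Categories.
Set Implicit Arguments.
Unset Strict Implicit.
Import GRing.Theory Defs.
Local Open Scope cat_scope.
Implicit Types C D : preadditive.

Lemma is_iso_id C (X : C) : is_iso (idm X).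
Proof. by exists (idm X); rewrite comp_idl. Qed.

Lemma is_iso_comp C (X Y Z : C) (g : hom Y Z) (f : hom X Y) :
  is_iso g -> is_iso f -> is_iso (g ∘ f).
Proof.
move=> [g' [g'g gg']] [f' [f'f ff']]; exists (f' ∘ g'); split.
  by rewrite compA -[_ ∘ g' ∘ g]compA g'g comp_idr.
by rewrite compA -[_ ∘ f ∘ f']compA ff' comp_idr.
Qed.

Lemma is_iso_fmap C D (F : functor C D) (X Y : C) (f : hom X Y) :
  is_iso f -> is_iso (fmap F f).
Proof.
by move=> [g [gf fg]]; exists (fmap F g); rewrite -!fmap_comp gf fg !fmap_id.
Qed.

Lemma fmap_square C D (F : functor C D) (X Y X' Y' : C) (a : hom X X')
    (b : hom Y Y') (f : hom X Y) (f' : hom X' Y') :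
  b ∘ f = f' ∘ a -> fmap F b ∘ fmap F f = fmap F f' ∘ fmap F a.
Proof. by move=> sq; rewrite -!fmap_comp sq. Qed.

Lemma isomorphic_refl C (X : C) : isomorphic X X.
Proof. by exists (idm X); apply: is_iso_id. Qed.

Lemma isomorphic_sym C (X Y : C) : isomorphic X Y -> isomorphic Y X.
Proof. by move=> [f [g [gf fg]]]; exists g, f. Qed.

Lemma isomorphic_trans C (Y X Z : C) :
  isomorphic X Y -> isomorphic Y Z -> isomorphic X Z.
Proof. by move=> [f fi] [g gi]; exists (g ∘ f); apply: is_iso_comp. Qed.

Lemma isomorphic_fobj C D (F : functor C D) (X Y : C) :
  isomorphic X Y -> isomorphic (F X) (F Y).
Proof. by move=> [f fi]; exists (fmap F f); apply: is_iso_fmap. Qed.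

Lemma is_iso_square C (X Y X' Y' : C) (a : hom X X') (b : hom Y Y')
    (f : hom X Y) (f' : hom X' Y') :
  is_iso a -> is_iso b -> b ∘ f = f' ∘ a -> is_iso f -> is_iso f'.
Proof.
move=> [a' [a'a aa']] bi sq fi.
have -> : f' = b ∘ f ∘ a' by rewrite sq -compA aa' comp_idr.
by do 2?apply: is_iso_comp => //; exists a.
Qed.

Lemma nat_isomorphic_refl C D (F : functor C D) : nat_isomorphic F F.
Proof.
exists (fun X => idm (F X)); split=> [X|X Y f]; first exact: is_iso_id.
by rewrite comp_idl comp_idr.
Qed.

Lemma nat_isomorphic_sym C D (F G : functor C D) :
  nat_isomorphic F G -> nat_isomorphic G F.
Proof.
move=> [eta [eta_iso nat]].
pose inv X := sval (boolp.cid (eta_iso X)).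
have invP X : inv X ∘ eta X = idm (F X) /\ eta X ∘ inv X = idm (G X).
  exact: (svalP (boolp.cid (eta_iso X))).
exists inv; split=> [X|X Y f].
  by exists (eta X); have [? ?] := invP X.
apply: (iso_mono (eta_iso Y)).
by rewrite !compA (invP Y).2 comp_idl nat -compA (invP X).2 comp_idr.
Qed.

Lemma nat_isomorphic_trans C D (G F H : functor C D) :
  nat_isomorphic F G -> nat_isomorphic G H -> nat_isomorphic F H.
Proof.
move=> [e [ei en]] [e' [ei' en']]; exists (fun X => e' X ∘ e X).
split=> [X|X Y f]; first exact: is_iso_comp.
by rewrite -compA en !compA en'.
Qed.

Lemma nat_isomorphic_compl C D (E : preadditive) (K : functor D E)
    (F G : functor C D) :
  nat_isomorphic F G -> nat_isomorphic (compF K F) (compF K G).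
Proof.
move=> [e [ei en]]; exists (fun X => fmap K (e X)).
split=> [X|X Y f] /=; first exact: is_iso_fmap.
by rewrite -!fmap_comp en.
Qed.

Lemma nat_isomorphic_compr C D (E : preadditive) (K : functor C D)
    (F G : functor D E) :
  nat_isomorphic F G -> nat_isomorphic (compF F K) (compF G K).
Proof.
move=> [e [ei en]]; exists (fun X => e (K X)).
by split=> [X|X Y f] /=; [apply: ei | apply: en].
Qed.

Lemma nat_isomorphic_obj C D (F G : functor C D) X :
  nat_isomorphic F G -> isomorphic (F X) (G X).
Proof. by move=> [e [ei _]]; exists (e X). Qed.

Lemma nat_isomorphic_iso C D (F G : functor C D) (X Y : C) (f : hom X Y) :
  nat_isomorphic F G -> is_iso (fmap F f) -> is_iso (fmap G f).
Proof. by move=> [e [ei en]]; apply: (is_iso_square (ei X) (ei Y)). Qed.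

(** Fullness of an equivalence: conjugate G g by the natural isomorphism, and
    check the result after applying G, which is faithful. *)
Lemma nat_id_full C (F G : functor C C) :
    nat_isomorphic (compF G F) (idF C) -> nat_isomorphic (compF F G) (idF C) ->
  forall (X Y : C) (g : hom (F X) (F Y)), exists f, fmap F f = g.
Proof.
move=> [eta [eta_iso nat]] FG X Y g.
have G_faith U V (u v : hom U V) : fmap G u = fmap G v -> u = v.
  by move=> uv; apply: (nat_id_faithful FG); rewrite /= uv.
have [e [eK Ke]] := eta_iso X.
exists (eta Y ∘ fmap G g ∘ e); apply: G_faith.
apply: (iso_mono (eta_iso Y)).
by rewrite (nat _ _ (eta Y ∘ fmap G g ∘ e)) /= -!compA eK comp_idr.
Qed.

End Categories.

(** * Shifts by integers *)

Section Shifts.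
Set Implicit Arguments.
Unset Strict Implicit.
Import GRing.Theory Defs.
Local Open Scope cat_scope.
Variable T : triangulated.

(** The two branches of [shift] iterate different functors, so one more
    suspension gives the next shift on the nose for n >= 0, and up to
    isomorphism, by cancelling a desuspension, for n < 0. *)
Lemma susp_shift (n : int) :
  nat_isomorphic (compF susp (shift T n)) (shift T (n + 1)).
Proof.
case: n => [k|k].
  have -> : (Posz k + 1 = Posz k.+1)%R by lia.
  exact: nat_isomorphic_refl.
have -> : (Negz k + 1 = - Posz k)%R by lia.
have E : shift T (Negz k) = compF desusp (shift T (- Posz k)) by case: k.
rewrite E.
exact: (nat_isomorphic_compr (shift T (- Posz k)) (desuspK T)).
Qed.

Lemma desusp_shift (n : int) :
  nat_isomorphic (compF desusp (shift T n)) (shift T (n - 1)).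
Proof.
case: n => [[|k]|k].
- exact: nat_isomorphic_refl.
- have -> : (Posz k.+1 - 1 = Posz k)%R by lia.
  exact: (nat_isomorphic_compr (shift T (Posz k)) (suspK T)).
have -> : (Negz k - 1 = Negz k.+1)%R by lia.
exact: nat_isomorphic_refl.
Qed.

Lemma shiftD (m n : int) :
  nat_isomorphic (compF (shift T m) (shift T n)) (shift T (m + n)).
Proof.
case: m => k; elim: k => [|k IH].
- by rewrite add0r; apply: nat_isomorphic_refl.
- have -> : (Posz k.+1 + n = Posz k + n + 1)%R by lia.
  apply: nat_isomorphic_trans (susp_shift (Posz k + n)).
  exact: (nat_isomorphic_compl susp IH).
- have -> : (Negz 0 + n = n - 1)%R by lia.
  exact: desusp_shift.
have -> : (Negz k.+1 + n = Negz k + n - 1)%R by lia.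
apply: nat_isomorphic_trans (desusp_shift (Negz k + n)).
exact: (nat_isomorphic_compl desusp IH).
Qed.

Lemma shiftK (m n : int) : m + n = 0 ->
  nat_isomorphic (compF (shift T m) (shift T n)) (idF T).
Proof. by move=> mn; have := shiftD m n; rewrite mn. Qed.

Lemma shift_faithful (n : int) (X Y : T) (f g : hom X Y) :
  fmap (shift T n) f = fmap (shift T n) g -> f = g.
Proof.
move=> fg; apply: (nat_id_faithful (shiftK (addNr n))).
by rewrite /= fg.
Qed.

Lemma shift_full (n : int) (X Y : T) (g : hom (shift T n X) (shift T n Y)) :
  exists f, fmap (shift T n) f = g.
Proof. exact: nat_id_full (shiftK (addNr n)) (shiftK (addrN n)) _ _ g. Qed.

Lemma shift_shift_sub (Q : T -> Prop) (m n : int) (X : T) :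
  shift_sub Q n X -> shift_sub Q (m + n) (shift T m X).
Proof.
move=> [Y [QY XY]]; exists Y; split=> //.
apply: (isomorphic_trans (isomorphic_fobj (shift T m) XY)).
exact: nat_isomorphic_obj (shiftD m n).
Qed.

End Shifts.

(** * Exact triangles and Hom-groups *)

Section HomBijections.
Set Implicit Arguments.
Unset Strict Implicit.
Import GRing.Theory Defs.
Local Open Scope cat_scope.
Variable T : triangulated.

(** Bijectivity of Hom(W, f), stated as trivial kernel and surjectivity. *)
Definition hom_bij (W X Y : T) (f : hom X Y) : Prop :=
  (forall w : hom W X, f ∘ w = 0 -> w = 0) /\
  (forall u : hom W Y, exists w, f ∘ w = u).

Lemma hom_bij_square (W X Y X' Y' : T) (a : hom X X') (b : hom Y Y')
    (f : hom X Y) (f' : hom X' Y') :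
  is_iso a -> is_iso b -> b ∘ f = f' ∘ a -> hom_bij W f -> hom_bij W f'.
Proof.
move=> [a' [a'a aa']] bi sq [finj fsur].
have [b' [b'b bb']] := bi; split=> [w f'w|u].
  have aw : a' ∘ w = 0.
    apply: finj; apply: (iso_mono bi).
    by rewrite comp0r compA sq compA -[_ ∘ a ∘ a']compA aa' comp_idr.
  by rewrite -[w]comp_idl -aa' -compA aw comp0r.
have [w fw] := fsur (b' ∘ u); exists (a ∘ w).
by rewrite compA -sq -compA fw compA bb' comp_idl.
Qed.

Lemma hom_bij_susp (W X Y : T) (f : hom X Y) :
  hom_bij (susp W) (fmap susp f) <-> hom_bij W f.
Proof.
split=> [] [finj fsur]; split=> [w fw|u].
- apply: susp_faithful; rewrite susp0; apply: finj.
  by rewrite -fmap_comp fw susp0.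
- have [w fw] := fsur (fmap susp u); have [v wE] := susp_full w.
  by exists v; apply: susp_faithful; rewrite fmap_comp wE.
- have [v wE] := susp_full w; rewrite -wE (finj v) ?susp0 //.
  by apply: susp_faithful; rewrite fmap_comp wE fw susp0.
have [v <-] := susp_full u; have [w <-] := fsur v.
by exists (fmap susp w); rewrite fmap_comp.
Qed.

Lemma dist_comp0 (X Y Z : T) (f : hom X Y) (g : hom Y Z) (h : hom Z (susp X)) :
  dist f g h -> g ∘ f = 0.
Proof.
move=> D; have [[O O0] _] := tcat_additive T.
have [|c [cg _]] := dist_fill (a := idm X) (b := f) (dist_id X O0) D.
  by rewrite comp_idr.
by rewrite -cg comp0r.
Qed.

Lemma dist_comp0_susp (X Y Z : T) (f : hom X Y) (g : hom Y Z)
    (h : hom Z (susp X)) :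
  dist f g h -> fmap susp f ∘ h = 0.
Proof.
move=> /dist_rot/dist_rot/dist_comp0; rewrite compNl => /eqP.
by rewrite oppr_eq0 => /eqP.
Qed.

(** Exactness of Hom(W, -) at the term before X in the triangle rotated
    backwards, written with W[1] in place of a desuspension of Z. *)
Lemma dist_susp_lift (W X Y Z : T) (f : hom X Y) (g : hom Y Z)
    (h : hom Z (susp X)) (w : hom W X) :
  dist f g h -> f ∘ w = 0 -> exists k : hom (susp W) Z, h ∘ k = fmap susp w.
Proof.
move=> /dist_rot/dist_rot D fw; apply: (dist_lift D).
by rewrite compNl -fmap_comp fw susp0 oppr0.
Qed.

(** A section v of f comes from exactness at Y; it is also a retraction because
    Hom(X, f) is injective, the obstruction factoring through Z. *)
Lemma dist_iso_of_zero (X Y Z : T) (f : hom X Y) (g : hom Y Z)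
    (h : hom Z (susp X)) :
  dist f g h -> is_zero Z -> is_iso f.
Proof.
move=> D Z0.
have [|v fv] := dist_lift (u := idm Y) D; first by rewrite ((Z0 _).2 g) comp0l.
exists v; split=> //; apply/eqP; rewrite -subr_eq0; apply/eqP.
have [|k] := dist_susp_lift (w := v ∘ f - idm X) D.
  by rewrite compDr compNr compA fv comp_idl comp_idr subrr.
rewrite ((Z0 _).1 h) comp0l => k0.
by apply: susp_faithful; rewrite susp0.
Qed.

(** Five lemma.  The outer map Hom(W, R[-1]) -> Hom(W, R'[-1]) appears as
    Hom(W[1], R) -> Hom(W[1], R'). *)
Lemma hom_bij_five (W K K' X X' R R' : T)
    (i : hom K X) (p : hom X R) (d : hom R (susp K))
    (i' : hom K' X') (p' : hom X' R') (d' : hom R' (susp K'))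
    (a : hom K K') (b : hom X X') (c : hom R R') :
    dist i p d -> dist i' p' d' ->
    b ∘ i = i' ∘ a -> c ∘ p = p' ∘ b -> fmap susp a ∘ d = d' ∘ c ->
    is_iso a -> hom_bij W c -> hom_bij (susp W) c ->
  hom_bij W b.
Proof.
move=> D D' sqi sqp sqd ai [cinj csur] [_ csur'].
have [a' [a'a aa']] := ai; have /dist_rot Dr := D.
have Sai : is_iso (fmap susp a) by apply: is_iso_fmap.
split=> [w bw|u].
  have pw : p ∘ w = 0 by apply: cinj; rewrite compA sqp -compA bw comp0r.
  have [k kE] := dist_lift D pw.
  have [|z' z'E] := dist_susp_lift (w := a ∘ k) D'.
    by rewrite compA -sqi -compA kE bw.
  have [z zE] := csur' z'.
  have dz : d ∘ z = fmap susp k.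
    by apply: (iso_mono Sai); rewrite compA sqd -compA zE z'E fmap_comp.
  apply: susp_faithful; rewrite -kE fmap_comp -dz compA susp0.
  by rewrite (dist_comp0_susp D) comp0l.
have [v vE] := csur (p' ∘ u).
have dv : d ∘ v = 0.
  apply: (iso_mono Sai); rewrite comp0r compA sqd -compA vE compA.
  by rewrite (dist_comp0 (proj1 (dist_rot _ _ _) D')) comp0l.
have [w wE] := dist_lift Dr dv.
have [|k kE] := dist_lift (u := u - b ∘ w) D'.
  by rewrite compDr compNr compA -sqp -compA wE vE subrr.
exists (w + i ∘ (a' ∘ k)).
rewrite compDr compA sqi -compA [a ∘ _]compA aa' comp_idl kE.
by rewrite addrCA subrr addr0.
Qed.

End HomBijections.

(** * Truncations and cohomology *)

Section Truncations.
Set Implicit Arguments.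
Unset Strict Implicit.
Import GRing.Theory Defs.
Local Open Scope cat_scope.
Variables (T : triangulated) (t : t_structure T).

Notation ge1 := (shift_sub (tge0 t) (-1)).
Notation Q := (tau_ge1 t).

Lemma tge0_desusp X : tge0 t X -> tge0 t (desusp X).
Proof.
move=> X0; apply: tge0_sub; exists X; split=> //.
exact: isomorphic_refl.
Qed.

Lemma ge1_desusp X : ge1 X -> ge1 (desusp X).
Proof.
move=> [Y [Y0 XY]]; exists (desusp Y); split; first exact: tge0_desusp.
exact: (isomorphic_fobj desusp XY).
Qed.

Lemma ge1_iso X Y : isomorphic X Y -> ge1 Y -> ge1 X.
Proof.
by move=> XY [Z [Z0 YZ]]; exists Z; split=> //; apply: isomorphic_trans YZ.
Qed.

(** Immediate from the adjunction Hom(W, X) = Hom(W, tau_{<=0} X) for W in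
    T^{<=0}. *)
Lemma tau_le0_hom_bij (W X Y : T) (f : hom X Y) :
  tle0 t W -> is_iso (fmap (tau_le0 t) f) -> hom_bij W f.
Proof.
move=> W0 fi; split=> [w fw|u].
  have [v [vE _]] := tle0_lift w W0.
  rewrite -vE; suff -> : v = 0 by rewrite comp0r.
  apply: (iso_mono fi); rewrite comp0r.
  have [v' [_ v'U]] := tle0_lift (0 : hom W Y) W0.
  transitivity v'; [symmetry|]; apply: v'U; last by rewrite comp0r.
  by rewrite compA /= tau_le0_mapE -compA vE.
have [v [vE _]] := tle0_lift u W0; have [g [_ fg]] := fi.
exists (tt_i (trunc t X) ∘ (g ∘ v)).
by rewrite compA -tau_le0_mapE -compA [tau_le0_map t f ∘ _]compA fg comp_idl.
Qed.

(** TR3 provides some third map making a morphism of triangles; by uniqueness of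
    extensions to T^{>=1} it can only be tau_{>=1} f. *)
Lemma trunc_map_connecting (X Y : T) (f : hom X Y) :
  fmap susp (tau_le0_map t f) ∘ tt_d (trunc t X) =
  tt_d (trunc t Y) ∘ tau_ge1_map t f.
Proof.
have [] := dist_fill (a := tau_le0_map t f) (b := f)
  (tt_dist (trunc t X)) (tt_dist (trunc t Y)).
  by rewrite tau_le0_mapE.
by move=> c [/tau_ge1_map_uniq <-].
Qed.

(** For Z in T^{>=1} also Z[-1] lies in T^{>=1}, and maps X[1] -> Z correspond
    to maps X -> Z[-1]; these extend uniquely along X -> tau_{>=1} X. *)
Lemma susp_tau_ge1_extend (X Z : T) : ge1 Z ->
  forall u : hom (susp X) Z, exists! v, v ∘ fmap susp (tt_p (trunc t X)) = u.
Proof.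
move=> Z1 u; have [eta [eta_iso _]] := desuspK T; have [e [eK Ke]] := eta_iso Z.
have [u0 u0E] := susp_full (e ∘ u).
have [v [vE vU]] := tge1_extend u0 (ge1_desusp Z1).
exists (eta Z ∘ fmap susp v); split=> [|v' v'E].
  by rewrite -compA -fmap_comp vE u0E compA Ke comp_idl.
have [v0 v0E] := susp_full (e ∘ v').
rewrite (vU v0) ?v0E ?compA ?Ke ?comp_idl //.
by apply: susp_faithful; rewrite fmap_comp v0E u0E -compA v'E.
Qed.

(** tau_{>=1} (X[1]) = tau_{>=1} ((tau_{>=1} X)[1]): both sides corepresent the
    functor Hom(X[1], -) on T^{>=1}, by the previous lemma. *)
Lemma is_iso_tau_susp_p (X : T) :
  is_iso (fmap Q (fmap susp (tt_p (trunc t X)))).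
Proof.
set s := fmap susp _; set A := trunc t (susp X).
have [v [vE _]] := susp_tau_ge1_extend (tt_ge1 A) (tt_p A).
have [q [qE _]] := tge1_extend v (tt_ge1 A).
exists q; split.
  have [z [_ zU]] := tge1_extend (tt_p A) (tt_ge1 A).
  transitivity z; [symmetry|]; apply: zU; last by rewrite comp_idl.
  by rewrite -compA /= tau_ge1_mapE compA qE vE.
set B := trunc t (susp (tt_ge (trunc t X))).
have [z [_ zU]] := tge1_extend (tt_p B) (tt_ge1 B).
transitivity z; [symmetry|]; apply: zU; last by rewrite comp_idl.
rewrite -compA qE.
have [y [_ yU]] := susp_tau_ge1_extend (tt_ge1 B) (tt_p B ∘ s).
transitivity y; [symmetry|]; apply: yU => //.
by rewrite -compA vE /= tau_ge1_mapE.
Qed.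

(** Tested on W in T^{<=k+1}, f1 = tau_{>=1} (f[m]) is bijective, given that
    H^{n+1}(f) = tau_{<=0} ((tau_{>=1} (f[n]))[1]) is an isomorphism for n >= 0.
    The shift m is a variable because the induction on k raises it. *)
Lemma tau_ge1_hom_bij (X Y : T) (f : hom X Y) :
    (forall n : nat, is_iso (fmap (tau_le0 t)
       (fmap susp (fmap Q (fmap (shift T n) f))))) ->
  forall (k m : nat) (W : T), tle0 t (shift T k.+1 W) ->
    hom_bij W (fmap Q (fmap (shift T m) f)).
Proof.
move=> H; elim=> [|k IH] m W Wk; apply/hom_bij_susp.
  exact: tau_le0_hom_bij.
have Wk' : tle0 t (shift T k.+1 (susp W)).
  have <- // : shift T k.+2 W = shift T k.+1 (susp W).
  by elim: (k.+1) => // j /= [->].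
(* the third term of the triangles is tau_{>=1} of f[m+1] *)
have c_bij V : tle0 t (shift T k.+1 V) ->
    hom_bij V (fmap Q (fmap susp (fmap Q (fmap (shift T m) f)))).
  move=> /(IH m.+1); apply: hom_bij_square.
  - exact: is_iso_tau_susp_p.
  - exact: is_iso_tau_susp_p.
  exact: (fmap_square Q (fmap_square susp (esym (tau_ge1_mapE t _)))).
apply: (hom_bij_five (tt_dist (trunc t _)) (tt_dist (trunc t _)))
  (esym (tau_le0_mapE _ _)) (tau_ge1_mapE _ _) (trunc_map_connecting _)
  (H m) _ _.
  exact: c_bij.
apply: c_bij.
have -> : shift T k.+1 (susp (susp W)) = susp (shift T k.+1 (susp W)).
  by elim: (k.+1) => // j /= [->].
exact: tle0_susp.
Qed.

(** The truncation tau_{<=0} V -> V vanishes by hypothesis, hence tau_{<=0} V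
    is zero and V is isomorphic to tau_{>=1} V. *)
Lemma ge1_of_orthogonal (V : T) :
  (forall W, tle0 t W -> forall u : hom W V, u = 0) -> ge1 V.
Proof.
move=> V0; set A := trunc t V.
have i0 : tt_i A = 0 by apply: V0; apply: tt_le0.
have le0 : idm (tt_le A) = 0.
  have [z [_ zU]] := tle0_lift (tt_i A) (tt_le0 A).
  by transitivity z; [symmetry|]; apply: zU; rewrite i0 ?comp0l.
apply: ge1_iso (tt_ge1 A); exists (tt_p A).
have /dist_rot/dist_iso_of_zero D := tt_dist A; apply: D => X.
have Sid : idm (susp (tt_le A)) = 0 by rewrite -fmap_id le0 susp0.
split=> k; first by rewrite -[k]comp_idr Sid comp0r.
by rewrite -[k]comp_idl Sid comp0l.
Qed.

(** Membership in some T^{<=n}; asking only for n >= 1 loses nothing, since the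
    T^{<=n} increase with n. *)
Definition bounded_above (W : T) : Prop :=
  exists k : nat, tle0 t (shift T k.+1 W).

Lemma bounded_above_desusp (W : T) :
  bounded_above W -> bounded_above (desusp W).
Proof.
move=> [k Wk]; exists k.+1; apply: tle0_iso Wk.
apply: isomorphic_sym.
apply: isomorphic_trans (nat_isomorphic_obj W (shiftD T k.+2 (-1))) _.
have -> : (Posz k.+2 + -1 = Posz k.+1)%R by lia.
exact: isomorphic_refl.
Qed.

Lemma orthogonal_shift (C : T) (n : nat) :
  (forall W, bounded_above W -> forall u : hom W C, u = 0) ->
  forall W, bounded_above W -> forall u : hom W (shift T n C), u = 0.
Proof.
move=> C0; elim: n => [|n IH] // W /bounded_above_desusp/IH W0 u.
have [eta [eta_iso _]] := desuspK T; have [v vE] := susp_full (u ∘ eta W).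
by apply: (iso_epi (eta_iso W)); rewrite comp0l -vE (W0 v) susp0.
Qed.

Hypothesis nondeg : t_nondegenerate t.

(** Every C[n] is orthogonal to T^{<=0}, hence lies in T^{>=1}, which is part of
    T^{>=0}: so C is in all T^{>=n}. *)
Lemma zero_of_orthogonal (C : T) :
  (forall W, bounded_above W -> forall u : hom W C, u = 0) -> is_zero C.
Proof.
move=> C0; apply/nondeg.1 => n.
exists (shift T n C); split; last first.
  exact/isomorphic_sym/(nat_isomorphic_obj C (shiftK T (addNr (Posz n)))).
apply/tge0_sub/ge1_of_orthogonal => W W0; apply: (orthogonal_shift C0).
by exists 0; apply: tle0_susp.
Qed.

(** The long exact sequence of Hom(W, -) makes the cone orthogonal to all
    bounded-above W. *)
Lemma is_iso_of_hom_bij (X Y : T) (f : hom X Y) :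
  (forall W, bounded_above W -> hom_bij W f) -> is_iso f.
Proof.
move=> fbij; have [C [g [h D]]] := dist_cone f.
apply: (dist_iso_of_zero D); apply: zero_of_orthogonal => W Wb u.
have /dist_rot Dr := D.
suff hu : h ∘ u = 0.
  have [w wE] := dist_lift Dr hu; have [w' w'E] := (fbij W Wb).2 w.
  by rewrite -wE -w'E compA (dist_comp0 D) comp0l.
have [eta [eta_iso _]] := desuspK T.
have [v vE] := susp_full (h ∘ u ∘ eta W).
apply: (iso_epi (eta_iso W)); rewrite comp0l -vE.
rewrite ((fbij _ (bounded_above_desusp Wb)).1 v) ?susp0 //.
apply: susp_faithful; rewrite fmap_comp vE !compA.
by rewrite (dist_comp0_susp D) !comp0l susp0.
Qed.

Lemma precomp_bij_ge1 (X Y Z : T) (f : hom X Y) :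
    (forall n : nat, is_iso (fmap (tau_le0 t)
       (fmap susp (fmap Q (fmap (shift T n) f))))) -> ge1 Z ->
  forall u : hom X Z, exists! v, v ∘ f = u.
Proof.
move=> H Z1 u.
have [q [qf fq]] : is_iso (fmap Q f).
  apply: is_iso_of_hom_bij => W [k Wk].
  exact: (tau_ge1_hom_bij H 0%N Wk).
have [v [vE vU]] := tge1_extend u Z1.
exists (v ∘ q ∘ tt_p (trunc t Y)); split=> [|w wE].
  by rewrite -compA -tau_ge1_mapE compA -[v ∘ q ∘ _]compA qf comp_idr.
have [w0 [w0E _]] := tge1_extend w Z1.
rewrite (vU (w0 ∘ fmap Q f)) -?w0E -?[w0 ∘ _ ∘ q]compA ?fq ?comp_idr //.
by rewrite -compA /= tau_ge1_mapE compA w0E.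
Qed.

(** The general degree b reduces to b = 1 by the shift by b - 1: by definition
    H^{b+n}(f) = tau_{<=0} ((tau_{>=1} (f[b+n][-1]))[1]), and f[b+n][-1] is
    isomorphic to f[b-1][n]. *)
Lemma precomp_bij (b : int) (X Y Z : T) (f : hom X Y) :
    iso_in_degrees_ge t f b -> tge t b Z ->
  forall u : hom X Z, exists! v, v ∘ f = u.
Proof.
move=> fb Zb u.
have H (n : nat) : is_iso (fmap (tau_le0 t)
    (fmap susp (fmap Q (fmap (shift T n) (fmap (shift T (b - 1)) f))))).
  have := fb (b + n)%R; rewrite Num.Theory.lerDl => /(_ isT).
  apply: (nat_isomorphic_iso (f := f)
    (F := compF (tau_le0 t) (compF susp (compF Q
            (compF (shift T (-1)) (shift T (b + n))))))
    (G := compF (tau_le0 t) (compF susp (compF Q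
            (compF (shift T n) (shift T (b - 1))))))).
  do 3 apply: nat_isomorphic_compl.
  apply: nat_isomorphic_trans (shiftD T _ _) _.
  have -> : (-1 + (b + n) = Posz n + (b - 1))%R by lia.
  exact: nat_isomorphic_sym (shiftD T _ _).
have Z1 : ge1 (shift T (b - 1) Z).
  have := shift_shift_sub (b - 1) Zb.
  by have -> : (b - 1 + - b = -1)%R by lia.
have [v [vE vU]] := precomp_bij_ge1 H Z1 (fmap (shift T (b - 1)) u).
have [w wE] := shift_full v.
exists w; split=> [|w' w'E]; apply: (@shift_faithful _ (b - 1)).
  by rewrite fmap_comp wE.
by rewrite wE; apply: vU; rewrite -fmap_comp w'E.
Qed.

(** For m = n + k, W[-m] = (W[-k])[-n] with W[-k] still in T^{>=0}. *)
Lemma tge_sub (m n : int) (X : T) : n <= m -> tge t m X -> tge t n X.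
Proof.
move=> nm [W [W0 XW]].
have [k kE] : exists k : nat, m = n + k.
  by exists `|m - n|%N; lia.
exists (shift T (- Posz k) W); split.
  case: k {kE} => [|k] //=.
  change (tge0 t (shift T (Negz k) W)).
  by elim: k => [|k IH]; apply: tge0_desusp.
apply: isomorphic_trans XW _; apply: isomorphic_sym.
have -> : (- m = - n + - Posz k)%R by lia.
exact: nat_isomorphic_obj (shiftD T _ _).
Qed.

End Truncations.

Theorem lemma3p2 (T : triangulated) (t : t_structure T)
    (t_nondeg : t_nondegenerate t)
    (a N : int) (N_gt0 : 0 < N)
    (P E F F' : T) (f : hom P E) (g : hom F F')
    (f_iso : iso_in_degrees_ge t f (a - N)) (E_ge : tge t a E)
    (g_iso : iso_in_degrees_ge t g a) (F'_ge : tge t (a - N) F')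
    (PF : is_retract P F) :
  is_retract E F'.
Proof.
case: PF => i [r ri].
have [j [jf _]] := precomp_bij t_nondeg f_iso F'_ge (Defs.comp g i).
have [s [sg _]] := precomp_bij t_nondeg g_iso E_ge (Defs.comp f r).
exists j, s.
have E_ge' : tge t (a - N) E by apply: tge_sub E_ge; lia.
have [e [_ eU]] := precomp_bij t_nondeg f_iso E_ge' f.
transitivity e; [symmetry|]; apply: eU; last by rewrite comp_idl.
by rewrite -Defs.compA jf Defs.compA sg -Defs.compA ri comp_idr.
Qed.
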